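(* Let $m\ge 2$, let $d$ be the Hamming distance on $\{0,1\}^m$, and let $\mathrm{DL}_m^2$ be the class of Boolean functions on $\{0,1\}^m$ that are representable by 1-decision lists with at most $2$ label alternations. Then $$\mathcal{S}_{\mathrm{CS}^d_{\min}}(\mathrm{DL}^2_m)\ \ge\ 2^{m-2}-1 .$$
   Context: 1-decision lists. A 1-decision list over Boolean variables $v_1,\dots,v_m$ is a list $\mathcal{L}=[(\ell_1,b_1),\ldots,(\ell_z,b_z),b_{z+1}]$ with $z\ge0$, literals $\ell_i\in\{v_1,\bar v_1,\ldots,v_m,\bar v_m\}$ and $b_i\in\{0,1\}$, where each variable occurs at most once (negated or not). It represents the function $f_{\mathcal{L}}:\{0,1\}^m\to\{0,1\}$ with $f_{\mathcal{L}}(\mathbf a)=b_k$ if $\ell_k$ evaluates to $1$ on $\mathbf a$ while $\ell_1,\dots,\ell_{k-1}$ evaluate to $0$ on $\mathbf a$, and $f_{\mathcal{L}}(\mathbf a)=b_{z+1}$ if all of $\ell_1,\dots,\ell_z$ evaluate to $0$ on $\mathbf a$. The number of label alternations of $\mathcal{L}$ is the number of indices $i\in\{1,\dots,z\}$ with $b_{i+1}\ne b_i$. Minimum distance model. Concepts over $\mathcal{X}=\{0,1\}^m$ are functions $\mathcal{X}\to\{0,1\}$. For $x\in\mathcal{X}$ and a concept $C$, let $\mathrm{CS}^d_{\min}(x,C)$ be the set of all $x'\in\mathcal{X}$ with $C(x')\ne C(x)$ that minimize $d(x,x')$ among all points of $\mathcal{X}$ whose label differs from $C(x)$ (empty if no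 such point exists). Learning with contrast sets. Let $\mathrm{CS}$ assign to each pair $(x,C)$ a subset of $\mathcal{X}$. A deterministic learner, who knows the concept class $\mathcal{C}$ and $\mathrm{CS}$, tries to identify an unknown $C^*\in\mathcal{C}$. The initial version space is $\mathcal{C}_1=\mathcal{C}$. In round $i\ge1$ the learner, depending on all previous queries and responses, chooses $x_i\in\mathcal{X}$. The oracle returns $y_i=C^*(x_i)$ and, if $\mathrm{CS}(x_i,C^* )\neq\emptyset$, a pair $(x_i',y_i')$ where $x'_i\in\mathrm{CS}(x_i,C^* )$ is chosen adversarially and $y'_i=C^*(x_i')$; if $\mathrm{CS}(x_i,C^* )=\emptyset$ it returns $y_i$ and a dummy symbol $\omega$. The new version space $\mathcal{C}_{i+1}$ consists of all $C\in\mathcal{C}_i$ with $C(x_i)=y_i$ and, if $\omega$ was returned, $\mathrm{CS}(x_i,C)=\emptyset$, and otherwise $C(x'_i)=y'_i$ and $x'_i\in\mathrm{CS}(x_i,C)$. The target is identified after $n$ rounds if $\mathcal{C}_{n+1}=\{C^*\}$. $\mathcal{S}_{\mathrm{CS}}(\mathcal{C})$ is the infimum over learners of the supremum, over $C^*\in\mathcal{C}$ and all admissible oracle choices, of the number of rounds until the target is identified. *)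

(* Defs.v *)
From mathcomp Require Import all_boot all_order all_algebra.
From mathcomp Require Import all_classical all_reals all_analysis.

Set Implicit Arguments.
Unset Strict Implicit.
Unset Printing Implicit Defensive.

Import Order.TTheory GRing.Theory Num.Theory.
Local Open Scope classical_set_scope.

Section Learning.
Variable X : Type.

Definition concept := X -> bool.

(* The contrastive part of a response is [Some (x', y')], or [None] for the
   dummy symbol. *)
Definition response : Type := bool * option (X * bool).

Definition record : Type := X * response.

(* The next query depends on all previous queries and responses. *)
Definition learner := seq record -> X.

Variable CS : X -> concept -> set X.

Definition consistent (r : record) (C : concept) : Prop :=
  let: (x, (y, c)) := r in
  C x = y /\
  match c with
  | None => CS x C = set0
  | Some (x', y') => C x' = y' /\ CS x C x'
  end.

Definition update (V : set concept) (r : record) : set concept :=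
  [set C | V C /\ consistent r C].

Definition version_space (Cs : set concept) (h : seq record) : set concept :=
  foldl update Cs h.

(* Rounds are numbered from 0: [o i] is the contrastive point picked by the
   oracle in round [i] ([None] if it returns the dummy symbol), and
   [transcript L C o n] is the history of the first [n] rounds. *)
Fixpoint transcript (L : learner) (C : concept) (o : nat -> option X)
    (n : nat) : seq record :=
  if n is k.+1 then
    let h := transcript L C o k in
    let x := L h in
    rcons h (x, (C x, omap (fun x' => (x', C x')) (o k)))
  else [::].

Definition admissible (L : learner) (C : concept) (o : nat -> option X) :=
  forall n, let x := L (transcript L C o n) in
  match o n with
  | None => CS x C = set0
  | Some x' => CS x C x'
  end.

Definition identified (Cs : set concept) (L : learner) (C : concept)
    (o : nat -> option X) (n : nat) : Prop :=
  version_space Cs (transcript L C o n) = [set C].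

Variable R : realType.

(* The infimum of the empty set is [+oo]: the target is never identified. *)
Definition num_rounds (Cs : set concept) (L : learner) (C : concept)
    (o : nat -> option X) : \bar R :=
  ereal_inf [set (n%:R)%:E | n in [set n | identified Cs L C o n]].

Definition worst_case (Cs : set concept) (L : learner) : \bar R :=
  ereal_sup [set num_rounds Cs L p.1 p.2 |
    p in [set p : concept * (nat -> option X) |
           Cs p.1 /\ admissible L p.1 p.2]].

Definition sample_complexity (Cs : set concept) : \bar R :=
  ereal_inf [set worst_case Cs L | L in [set: learner]].

End Learning.

Definition CSmin (X : Type) (d : X -> X -> nat) (x : X) (C : concept X) :
    set X :=
  [set x' | C x' <> C x /\
            forall z, C z <> C x -> (d x x' <= d x z)%N].

Definition cube (m : nat) := {ffun 'I_m -> bool}.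

Definition hamming (m : nat) (a b : cube m) : nat :=
  #|[set i : 'I_m | a i != b i]%SET|.

(* [(i, true)] is the positive literal of variable [i], [(i, false)] the
   negated one. *)
Definition literal (m : nat) : Type := 'I_m * bool.

Definition lit_holds (m : nat) (l : literal m) (a : cube m) : bool :=
  a l.1 == l.2.

Structure decision_list (m : nat) := DecisionList {
  dl_rules : seq (literal m * bool);
  dl_default : bool;
  dl_uniq : uniq [seq r.1.1 | r <- dl_rules]
}.

Fixpoint eval_rules (m : nat) (s : seq (literal m * bool)) (b : bool)
    (a : cube m) : bool :=
  if s is (l, c) :: s' then
    if lit_holds l a then c else eval_rules s' b a
  else b.

Definition dl_fun (m : nat) (D : decision_list m) : concept (cube m) :=
  eval_rules (dl_rules D) (dl_default D).

Definition dl_labels (m : nat) (D : decision_list m) : seq bool :=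
  rcons [seq r.2 | r <- dl_rules D] (dl_default D).

Definition alternations (m : nat) (D : decision_list m) : nat :=
  #|[set i : 'I_(size (dl_rules D)) |
      nth false (dl_labels D) i.+1 != nth false (dl_labels D) i]%SET|.

Definition DL (m k : nat) : set (concept (cube m)) :=
  [set f | exists D : decision_list m,
             (alternations D <= k)%N /\ f = dl_fun D].

Arguments DL m k : clear implicits.
Arguments hamming m a b : clear implicits.

(* Main.v *)
Require Import Defs.
From mathcomp Require Import all_boot all_order all_algebra.
From mathcomp Require Import all_classical all_reals all_analysis.

Import Order.TTheory GRing.Theory Num.Theory.

Local Open Scope ring_scope.

(** The target is the dictator [x |-> x i], and the oracle always answers with
    the query flipped at [i].  For a point [a], the function "[x i], or [x]
    agrees with [a] off [i]" is a decision list with two label alternations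
    that gives exactly the same responses unless the query is [a] or [a]
    flipped at [i].  So each query refutes at most one of these [2 ^ (m - 1)]
    functions, and the target is not identified in fewer rounds. *)

Lemma version_space_transcript (X : Type) (CS : X -> concept X -> set X)
    (Cs : set (concept X)) (L : learner X) (C : concept X)
    (o : nat -> option X) (n : nat) (D : concept X) :
  Cs D ->
  (forall k, (k < n)%N -> let x := L (transcript L C o k) in
     consistent CS (x, (C x, omap (fun x' => (x', C x')) (o k))) D) ->
  version_space CS Cs (transcript L C o n) D.
Proof.
move=> CsD; elim: n => [|n IHn] // cons.
rewrite /version_space /= foldl_rcons; split; last exact: cons.
by apply: IHn => k kn; apply: cons; exact: ltnW.
Qed.

(* An oracle is a sequence indexed by rounds, so a stationary strategy has to be
   unrolled along the play against [L]. *)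
Lemma stationary_oracle (X : Type) (L : learner X) (C : concept X)
    (s : X -> option X) :
  exists o, forall n, o n = s (L (transcript L C o n)).
Proof.
pose step h := let x := L h in
  rcons h (x, (C x, omap (fun x' => (x', C x')) (s x))).
exists (fun n => s (L (iter n step [::]))) => n.
suff -> : transcript L C (fun n => s (L (iter n step [::]))) n
          = iter n step [::] by [].
by elim: n => //= n ->.
Qed.

Lemma hamming_gt0 (m : nat) (x z : cube m) : x != z -> (0 < hamming m x z)%N.
Proof.
move=> xz; rewrite card_gt0; apply: contra xz => /eqP xz0.
apply/eqP/ffunP => j; apply/eqP.
by move/finset.setP: xz0 => /(_ j); rewrite !inE => /negbFE.
Qed.

Section Flip.
Variables (m : nat) (i : 'I_m).

Definition flip (x : cube m) : cube m :=
  [ffun j => if j == i then ~~ x j else x j].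

Lemma flip_at x : flip x i = ~~ x i.
Proof. by rewrite ffunE eqxx. Qed.

Lemma flipK : involutive flip.
Proof.
by move=> x; apply/ffunP => j; rewrite !ffunE; case: eqP; rewrite ?negbK.
Qed.

Lemma hamming_flip x : hamming m x (flip x) = 1%N.
Proof.
rewrite /hamming (_ : [set j | _]%SET = [set i]%SET) ?cards1 //.
apply/finset.setP => j; rewrite !inE ffunE; case: (j == i); last by rewrite eqxx.
by case: (x j).
Qed.

(** A point with another label differs from [x], so it lies at distance at least 1, and the flip
    attains this. *)
Lemma CSmin_flip (C : concept (cube m)) x :
  C (flip x) <> C x -> CSmin (hamming m) x C (flip x).
Proof.
move=> Cx; split=> // z Cz; rewrite hamming_flip hamming_gt0 //.
by apply/eqP => xz; rewrite xz in Cz.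
Qed.

Definition dictator : concept (cube m) := fun x => x i.

Lemma DL_dictator k : (0 < k)%N -> DL m k dictator.
Proof.
move=> k0; exists (@DecisionList m [:: ((i, true), true)] false isT); split.
  (* A single rule leaves only one index at which the labels can alternate. *)
  by apply: leq_trans k0; rewrite -[leqRHS](card_ord 1) max_card.
by apply/funext => x; rewrite /dl_fun /= /lit_holds /dictator /=; case: (x i).
Qed.

Definition fibre_or (a : cube m) : concept (cube m) :=
  fun x => x i || [forall (j | j != i), x j == a j].

Lemma agree_off_flip (a x : cube m) :
  [forall (j | j != i), x j == a j] = (x == a) || (x == flip a).
Proof.
apply/forall_inP/orP => [xa|[] /eqP-> j ji //]; last first.
  by rewrite ffunE (negbTE ji).
have [xai|xai] := eqVneq (x i) (a i); [left|right]; apply/eqP/ffunP => j;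
  rewrite ?ffunE; have [->//|ji] := eqVneq j i; try exact/eqP/xa.
by move: xai; case: (x i); case: (a i).
Qed.

Lemma fibre_or_dictator (a x : cube m) :
  a != x -> a != flip x -> fibre_or a x = dictator x.
Proof.
move=> ax afx; rewrite /fibre_or agree_off_flip eq_sym (negbTE ax) /=.
by rewrite eq_sym (inv_eq flipK) (negbTE afx) orbF.
Qed.

(** Whichever of [a] and [flip a] is false at [i] separates the two functions. *)
Lemma fibre_or_neq_dictator a : fibre_or a <> dictator.
Proof.
move=> e; have [ai|ai] := boolP (a i).
- have := congr1 (fun f => f (flip a)) e.
  by rewrite /fibre_or agree_off_flip eqxx !orbT /dictator flip_at ai.
- have := congr1 (fun f => f a) e.
  by rewrite /fibre_or agree_off_flip eqxx orbT /dictator (negbTE ai).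
Qed.

(** The rule for [j] fires, with label [false], exactly when [x] and [a] disagree at [j]; the
    default [true] is reached only if no rule fires. *)
Lemma eval_rules_conj (a : cube m) (s : seq 'I_m) (x : cube m) :
  eval_rules [seq ((j, ~~ a j), false) | j <- s] true x
  = all (fun j => x j == a j) s.
Proof.
elim: s => //= j s ->; rewrite /lit_holds /=.
by case: (x j); case: (a j).
Qed.

Lemma DL_fibre_or a : DL m 2 (fibre_or a).
Proof.
pose s := [seq j <- enum 'I_m | j != i].
pose rules := ((i, true), true) :: [seq ((j, ~~ a j), false) | j <- s].
have Ur : uniq [seq r.1.1 | r <- rules].
  rewrite /= -map_comp map_id mem_filter eqxx /=.
  by rewrite filter_uniq // enum_uniq.
exists (DecisionList true Ur); split; last first.
  apply/funext => x; rewrite /dl_fun /= eval_rules_conj /lit_holds /=.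
  rewrite /fibre_or; case: (x i) => //=; apply/forall_inP/allP => h j.
    by rewrite mem_filter => /andP[/h].
  by move=> ji; apply: h; rewrite mem_filter ji mem_enum.
rewrite /alternations /dl_labels /= -map_comp size_map.
(* The labels are [true], then [false] for each element of [s], then the default [true], so only the
   first and the last index can be alternations. *)
apply: (@leq_trans #|[set ord0; @ord_max (size s)]%SET|); last first.
  by rewrite cards2; case: (_ != _).
apply/subset_leq_card/fintype.subsetP => k; rewrite !inE.
apply: contraR; rewrite negb_or -!val_eqE /= => /andP[k0 ks].
have {}ks : (k < size s)%N by rewrite ltn_neqAle ks -ltnS ltn_ord.
case: (nat_of_ord k) k0 ks => //= k' _ ks.
rewrite !nth_rcons size_map ks (ltnW ks).
by rewrite !(nth_map i) // ltnW.
Qed.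

Lemma exists_off_orbits (s : seq (cube m)) :
  (2 * size s < 2 ^ m)%N ->
  (* The points of [s] and their flips number at most [2 * size s], so they do not cover the
     cube. *)
  exists a, forall x, x \in s -> a != x /\ a != flip x.
Proof.
move=> sm; pose t := s ++ map flip s.
have /fintype.subsetPn[a _ ta] : ~~ ([set: cube m]%SET \subset t).
  apply/negP => /subset_leq_card; apply/negP; rewrite -ltnNge.
  apply: leq_ltn_trans (card_size t) _.
  rewrite size_cat size_map addnn -mul2n cardsT card_ffun card_bool card_ord.
  exact: sm.
exists a => x xs; split; apply: contra ta => /eqP->; rewrite mem_cat ?xs //.
by rewrite (map_f flip xs) orbT.
Qed.

Lemma identified_dictator L (o : nat -> option (cube m)) n :
  (forall k, o k = Some (flip (L (transcript L dictator o k)))) ->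
  identified (CSmin (hamming m)) (DL m 2) L dictator o n ->
  (2 ^ m <= 2 * n)%N.
Proof.
move=> oE idn; rewrite leqNgt; apply/negP => nm.
pose q k := L (transcript L dictator o k).
have [|a aP] := @exists_off_orbits (map q (iota 0 n)).
  by rewrite size_map size_iota.
(* Too few queries leave a pair [a], [flip a] untouched; then [fibre_or a] survives in a version
   space that should contain the dictator alone. *)
apply: (@fibre_or_neq_dictator a); suff : [set dictator]%classic (fibre_or a) by [].
rewrite -idn; apply: version_space_transcript; first exact: DL_fibre_or.
move=> k kn /=; rewrite oE -/(q k).
have [aq afq] : a != q k /\ a != flip (q k).
  by apply: aP; rewrite map_f // mem_iota.
have eq_q : fibre_or a (q k) = dictator (q k) by exact: fibre_or_dictator.
have eq_fq : fibre_or a (flip (q k)) = dictator (flip (q k)).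
  by apply: fibre_or_dictator; rewrite ?flipK.
(* Agreement with the dictator at the query and at its flip suffices: the labels there differ, so
   the flip is a nearest contrast for [fibre_or a] too. *)
split=> //=; split=> //; apply: CSmin_flip.
by rewrite eq_q eq_fq /dictator flip_at; case: (q k i).
Qed.

End Flip.

Theorem corollary16 (R : realType) (m : nat) (hm : (2 <= m)%N) :
  ((2 ^+ (m - 2) - 1 : R)%:E
     <= sample_complexity (CSmin (hamming m)) R (DL m 2%N))%E.
Proof.
pose i : 'I_m := Ordinal (ltnW hm).
apply: le_ereal_inf_tmp => _ [L _ <-].
have [s sE] := @stationary_oracle _ L (@dictator m i) (fun x => Some (flip m i x)).
apply: (@le_trans _ _
  (num_rounds (CSmin (hamming m)) R (DL m 2) L (@dictator m i) s)); last first.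
  apply: ereal_sup_ubound; exists (@dictator m i, s) => //; split => /=.
    exact: DL_dictator.
  move=> n /=; rewrite sE; apply: CSmin_flip.
  by rewrite /dictator flip_at; case: (_ i).
apply: le_ereal_inf_tmp => _ [n /= /(identified_dictator _ _ _ _ _ sE) mn <-].
rewrite lee_fin lerBlDr -natrX natr1 ler_nat.
(* With [m] replaced by [m.+2], [mn] gives [2 * 2 ^ m <= n], which is more than the required
   [2 ^ m <= n.+1]. *)
case: m hm {i s sE L} mn => [|[|m]] // _; rewrite subn2 /= !expnS => mn.
apply: leqW; move: mn; rewrite leq_pmul2l //.
by apply: leq_trans; rewrite leq_pmull.
Qed.
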